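(* Let $\Gamma$ be a group. Set $G=\mathbb{Z}\wr\Gamma$ and $N=\bigoplus_{\Gamma}\mathbb{Z}$. (1) Let $\Lambda$ be a subgroup of $\Gamma$. Assume that $x\in N$ fulfills the following three conditions. (i) $e_\Gamma\in\mathrm{supp}(x)$. (ii) $\Lambda$ is a zero-sum set for $x$, namely, $\sum_{\lambda\in\Lambda}x(\lambda)=0$. (iii) For every zero-sum set $S$ for $x$ satisfying $S\subseteq\mathrm{supp}(x)$ and $e_\Gamma\in S$, we have $\langle S\rangle=\Lambda$. Then we have $\mathrm{cl}_{G,N}(x)=\mathrm{int}\text{-}\mathrm{rk}^\Gamma(\Lambda)$. (2) We have $$\{\mathrm{cl}_{G,N}(x)\mid x\in[G,N]\}=\{r\in\mathbb{Z}_{\ge0}\mid r\le\mathrm{gen}\text{-}\mathrm{rk}(\Gamma)\}.$$ Furthermore, for every integer $r\ge1$ with $r\le\mathrm{gen}\text{-}\mathrm{rk}(\Gamma)$, there exists $x_r\in[G,N]$ such that $\mathrm{cl}_{G,N}(x_r)=r$ and such that $x_r$ fulfills conditions (i)–(iii) of (1) with $\Lambda=\langle\mathrm{supp}(x_r)\rangle$.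
   Context: $e_\Gamma$ is the identity of $\Gamma$, and $\langle S\rangle$ is the subgroup of $\Gamma$ generated by a subset $S$. For groups $H,\Gamma$, the (restricted) wreath product is $H\wr\Gamma=\left(\bigoplus_\Gamma H\right)\rtimes\Gamma$, where $\Gamma$ acts by shifting coordinates: $(\lambda u)(\gamma)=u(\lambda^{-1}\gamma)$. Elements of $N=\bigoplus_\Gamma\mathbb{Z}$ are regarded as functions $x\colon\Gamma\to\mathbb{Z}$ with $x(\gamma)=0$ for all but finitely many $\gamma$. The support is $\mathrm{supp}(x)=\{\gamma\in\Gamma\mid x(\gamma)\neq0\}$. A subset $S\subseteq\Gamma$ is a zero-sum set for $x$ if $\sum_{s\in S}x(s)=0$. For a group $G$ and a normal subgroup $N$, a mixed commutator is an element $[g,x]=gxg^{-1}x^{-1}$ with $g\in G$, $x\in N$; $[G,N]$ is the subgroup generated by mixed commutators, and for $x\in[G,N]$, $\mathrm{cl}_{G,N}(x)$ is the smallest integer $n\ge 0$ such that $x$ is a product of $n$ mixed commutators. The rank of a group $\Lambda$ is $\mathrm{rk}(\Lambda)=\inf\{\#S\mid \Lambda=\langle S\rangle\}\in\mathbb{Z}_{\ge0}\cup\{\infty\}$. For a group $\Gamma$ and a subgroup $\Lambda$, the intermediate rank is $\mathrm{int}\text{-}\mathrm{rk}^\Gamma(\Lambda)=\inf\{\mathrm{rk}(\Theta)\mid \Lambda\leqslant\Theta\leqslant\Gamma\}\in\mathbb{Z}_{\ge0}\cup\{\infty\}$. The general rank of $\Gamma$ is $\mathrm{gen}\text{-}\mathrm{rk}(\Gamma)=\sup\{\mathrm{int}\text{-}\mathrm{rk}^\Gamma(\Lambda)\mid\Lambda\text{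 is a finitely generated subgroup of }\Gamma\}$.
   Formalization: In (1), x is additionally assumed to lie in [G,N], where cl is defined; (i)–(iii) alone do not imply this, e.g. x = δ_e − δ_a + 5δ_b with e, a, b distinct, b outside ⟨a⟩ and Λ = ⟨a⟩. *)

(* Defs.v *)
From HB Require Import structures.
From mathcomp Require Import all_boot all_order all_algebra finmap.
From mathcomp Require Import boolp classical_sets cardinality fsbigop.
From mathcomp Require Import monalg.

Set Implicit Arguments.
Unset Strict Implicit.
Unset Printing Implicit Defensive.

Import GRing.Theory.

Local Open Scope classical_set_scope.
Local Open Scope group_scope.

Inductive enat : Type := Fin of nat | Infty.

Definition le_enat (a b : enat) : Prop :=
  match a, b with
  | _, Infty => True
  | Infty, Fin _ => False
  | Fin m, Fin n => (m <= n)%N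
  end.

Definition inf_enat (A : set enat) : enat :=
  match pselect (exists n, `[< A (Fin n) >]) with
  | left A_fin => Fin (ex_minn A_fin)
  | right _ => Infty
  end.

Definition sup_enat (A : set enat) : enat :=
  inf_enat [set b | forall a, A a -> le_enat a b].

Lemma le_enat_trans (a b c : enat) : le_enat a b -> le_enat b c -> le_enat a c.
Proof. by case: a b c => [m|] [n|] [p|] //=; exact: leq_trans. Qed.

Lemma inf_enat_glb (A : set enat) (b : enat) :
  le_enat b (inf_enat A) <-> (forall a, A a -> le_enat b a).
Proof.
rewrite /inf_enat; case: pselect => [hA|hA].
  case: ex_minnP => n /asboolP An n_min; split=> [le_bn a Aa|]; last exact.
  apply: le_enat_trans le_bn _; case: a Aa => //= m Am.
  by apply: n_min; apply/asboolP.
split=> [_ a Aa|_]; last by case: b.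
case: a Aa => [m Am|_]; last by case: b.
by exfalso; apply: hA; exists m; apply/asboolP.
Qed.

Lemma sup_enat_lub (A : set enat) (b : enat) :
  le_enat (sup_enat A) b <-> (forall a, A a -> le_enat a b).
Proof.
split=> [le_Ab a Aa|ub_b].
  by apply: le_enat_trans le_Ab; apply/inf_enat_glb => c; apply.
have refl_le c : le_enat c c by case: c => //=.
by have /inf_enat_glb := refl_le (sup_enat A); apply.
Qed.

Definition card_enat (T : choiceType) (S : set T) : enat :=
  if `[< finite_set S >] then Fin #|` fset_set S| else Infty.

Section Subgroups.
Variable G : groupType.
Implicit Types (S L : set G).

Definition subgroup L : Prop :=
  [/\ L 1, forall a b, L a -> L b -> L (a * b) & forall a, L a -> L a^-1].

Definition generated S : set G :=
  \bigcap_(L in [set L | subgroup L /\ S `<=` L]) L.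

Definition finitely_generated L : Prop :=
  exists2 S, finite_set S & L = generated S.

Definition rk L : enat :=
  inf_enat [set card_enat S | S in [set S | L = generated S]].

Definition int_rk L : enat :=
  inf_enat [set rk M | M in [set M | subgroup M /\ L `<=` M]].

End Subgroups.

Definition gen_rk (G : groupType) : enat :=
  sup_enat
    [set int_rk L | L in [set L : set G | subgroup L /\ finitely_generated L]].

Section MixedCommutators.
Variables (G : groupType) (N : set G).

(* The bracket g x g^-1 x^-1 is not MathComp's [~ g, x] = g^-1 x^-1 g x. *)
Definition mixed_commutator : set G :=
  [set g * x * g^-1 * x^-1 | g in [set: G] & x in N].

Definition mixed_commutator_subgroup : set G := generated mixed_commutator.

Definition product_of_mixed (n : nat) (x : G) : Prop :=
  exists c : 'I_n -> G,
    (forall i, mixed_commutator (c i)) /\ x = \prod_(i < n) c i.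

(* Infty exactly when x is not in mixed_commutator_subgroup. *)
Definition cl (x : G) : enat :=
  inf_enat [set Fin n | n in [set n | product_of_mixed n x]].

End MixedCommutators.

(* The direct sum of copies of H over Gamma is {malg H[Gamma]}, the finitely  *)
(* supported functions from Gamma to H, with x@_g the value of x at g. Only   *)
(* its additive structure is used.                                            *)
Section Wreath.
Variables (H : zmodType) (Gamma : groupType).
Implicit Types (l m : Gamma) (u v : {malg H[Gamma]}).

Definition shift l u : {malg H[Gamma]} :=
  [malg g in [fset (l * h)%g | h in msupp u]%fset => u@_(l^-1 * g)%g]%R.

Lemma shiftE l u g : (shift l u)@_g = u@_(l^-1 * g)%g.
Proof.
rewrite mcoeffE; case: ifPn => // /imfsetP g_out.
apply/esym/mcoeff_outdom/negP => g_in; apply: g_out.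
by exists (l^-1 * g) => //=; rewrite mulVKg.
Qed.

Lemma shift1 u : shift 1 u = u.
Proof. by apply/malgP => g; rewrite shiftE invg1 mul1g. Qed.

Lemma shiftM l m u : shift (l * m) u = shift l (shift m u).
Proof. by apply/malgP => g; rewrite !shiftE invgM mulgA. Qed.

Lemma shiftD l u v : shift l (u + v)%R = (shift l u + shift l v)%R.
Proof. by apply/malgP => g; rewrite mcoeffD !shiftE mcoeffD. Qed.

Lemma shift0 l : shift l 0%R = 0%R :> {malg H[Gamma]}.
Proof. by apply/malgP => g; rewrite shiftE !mcoeff0. Qed.

Definition wreath : Type := ({malg H[Gamma]} * Gamma)%type.
HB.instance Definition _ := Choice.on wreath.

Definition wreath_one : wreath := (0%R, 1).
Definition wreath_mul (a b : wreath) : wreath :=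
  ((a.1 + shift a.2 b.1)%R, a.2 * b.2).
Definition wreath_inv (a : wreath) : wreath :=
  (shift a.2^-1 (- a.1)%R, a.2^-1).

Lemma wreath_mulA : associative wreath_mul.
Proof.
by move=> a b c; rewrite /wreath_mul /= shiftD shiftM addrA mulgA.
Qed.

Lemma wreath_mul1g : left_id wreath_one wreath_mul.
Proof. by case=> u l; rewrite /wreath_mul /= shift1 add0r mul1g. Qed.

Lemma wreath_mulg1 : right_id wreath_one wreath_mul.
Proof. by case=> u l; rewrite /wreath_mul /= shift0 addr0 mulg1. Qed.

Lemma wreath_mulVg : left_inverse wreath_one wreath_inv wreath_mul.
Proof.
by case=> u l; rewrite /wreath_mul /= -shiftD addNr shift0 mulVg.
Qed.

Lemma wreath_mulgV : right_inverse wreath_one wreath_inv wreath_mul.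
Proof.
by case=> u l; rewrite /wreath_mul /= -shiftM mulgV shift1 subrr.
Qed.

HB.instance Definition _ := isGroup.Build wreath
  wreath_mulA wreath_mul1g wreath_mulg1 wreath_mulVg wreath_mulgV.

Definition base_inj u : wreath := (u, 1).

Definition base : set wreath := range base_inj.

Lemma base_subgroup : subgroup base.
Proof.
split=> [|_ _ [u _ <-] [v _ <-]|_ [u _ <-]]; first by exists 0%R.
  exists (u + v)%R => //; congr pair; last by rewrite /= mulg1.
  by rewrite /= shift1.
exists (- u)%R => //; congr pair; last by rewrite /= invg1.
by rewrite /= invg1 shift1.
Qed.

Lemma base_normal (g x : wreath) : base x -> base (g * x * g^-1).
Proof.
by move=> [u _ <-]; exists (g * base_inj u * g^-1).1 => //; congr pair;
  rewrite /= mulg1 mulgV.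
Qed.

Definition supp u : set Gamma := [set` msupp u].

Definition zero_sum u (S : set Gamma) : Prop :=
  (\sum_(s \in S) u@_s = 0)%R.

Definition zero_sum_conditions u (L : set Gamma) : Prop :=
  [/\ supp u 1,
      zero_sum u L &
      forall S : set Gamma,
        zero_sum u S -> S `<=` supp u -> S 1 -> generated S = L].

End Wreath.

Arguments base : clear implicits.

(* Main.v *)
(* Mixed commutators in Z wr Gamma are the elements (l y - y) of the base.  If x
   is a sum of n of them, with l_1, ..., l_n generating Theta, then x has zero
   sum on Theta, since Theta is invariant under translation by each l_i;
   conversely, if the support of x lies in one right coset of Theta and its total
   sum is zero, then telescoping along words in the l_i writes x as such a sum.
   Under (i)-(iii), supp(x) and its intersection with Theta are zero-sum sets
   through the identity, so supp(x) lies in Lambda and Lambda lies in Theta.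
   For (2), the quotients of points of supp(x) generate a group bounding cl(x),
   and adjoining generators one by one shows that int-rk takes every value r up
   to gen-rk; (-k) e + s_1 + ... + s_k then realizes r. *)
Require Import Defs.
From mathcomp Require Import all_boot all_order all_algebra finmap.
From mathcomp Require Import boolp classical_sets functions cardinality fsbigop.
From mathcomp Require Import monalg.

Set Implicit Arguments.
Unset Strict Implicit.
Unset Printing Implicit Defensive.

Import GRing.Theory Num.Theory.

Local Open Scope classical_set_scope.

(** * Order and infima of extended naturals *)

Lemma le_enat_refl a : le_enat a a.
Proof. by case: a => /=. Qed.

Lemma le_enatNgt a n : ~ le_enat (Fin n.+1) a -> le_enat a (Fin n).
Proof. by case: a => //= m /negP; rewrite -leqNgt. Qed.

(** An infinite [b] makes both sides trivially true, so comparing two infima reduces to carrying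
    finite bounds across. *)
Lemma le_enatP a b :
  le_enat a b <-> (forall n, le_enat b (Fin n) -> le_enat a (Fin n)).
Proof.
split=> [ab n|]; first exact: le_enat_trans.
by case: b => [m|_]; [apply; exact: le_enat_refl | case: a].
Qed.

Lemma le_enat_anti a b : le_enat a b -> le_enat b a -> a = b.
Proof.
by case: a b => [m|] [n|] //= mn nm; congr Fin; apply/eqP; rewrite eqn_leq mn.
Qed.

Lemma inf_enat_leP (A : set enat) n :
  le_enat (inf_enat A) (Fin n) <-> exists2 m, (m <= n)%N & A (Fin m).
Proof.
split=> [|[m mn Am]]; last first.
  have /inf_enat_glb/(_ _ Am) := le_enat_refl (inf_enat A).
  by move/le_enat_trans; apply.
rewrite /inf_enat; case: pselect => // hA /=.
by case: ex_minnP => m /asboolP Am _ mn; exists m.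
Qed.

(** * Generated subgroups, rank and intermediate rank *)

Section Generation.
Variable G : groupType.
Implicit Types (S L : set G) (s : seq G).
Local Open Scope group_scope.

Lemma generated_subgroup S : subgroup (generated S).
Proof.
split=> [L [[]]//|a b aS bS L LS|a aS L LS]; have [[_ LM LV] _] := LS.
  by apply: LM; [exact: aS LS | exact: bS LS].
by apply: LV; exact: aS LS.
Qed.

Lemma sub_generated S : S `<=` generated S.
Proof. by move=> x Sx L [_]; apply. Qed.

Lemma generated_min S L : subgroup L -> S `<=` L -> generated S `<=` L.
Proof. by move=> ? ? x; apply. Qed.

Lemma generated_le S L : S `<=` generated L -> generated S `<=` generated L.
Proof. by move=> SL; apply: generated_min => //; exact: generated_subgroup. Qed.

Lemma generated_cons1 s : generated [set` 1 :: s] = generated [set` s].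
Proof.
apply/seteqP; split; apply: generated_le => k; rewrite /= ?inE.
  move=> /predU1P[->|ks]; last exact: sub_generated.
  by have [] := generated_subgroup [set` s].
by move=> ks; apply: sub_generated; rewrite /= inE ks orbT.
Qed.

(** Brings generators into the form that [zero_sum_witness] requires. *)
Lemma generated_uniq s : exists t : seq G,
  [/\ uniq t, 1 \notin t & generated [set` s] = generated [set` t]].
Proof.
exists (undup [seq k <- s | k != 1]).
split; rewrite ?undup_uniq ?mem_undup ?mem_filter ?eqxx//.
(* With [1] added to both lists, they have the same members. *)
rewrite -[RHS]generated_cons1; rewrite -[LHS]generated_cons1; congr generated.
apply/seteqP; split=> k /=; rewrite !inE mem_undup mem_filter.
all: by case: eqP.
Qed.

Lemma rk_leP L n : le_enat (rk L) (Fin n) <->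
  exists2 s : seq G, (size s <= n)%N & L = generated [set` s].
Proof.
rewrite inf_enat_leP; split=> [[m mn [S ->]]|[s sn ->]].
  rewrite /card_enat; case: asboolP => // Sfin [Sm].
  by exists (fset_set S); rewrite -?Sm in mn *; rewrite ?fset_setK.
(* Repetitions in [s] only make the underlying set smaller. *)
exists #|` fset_set [set` s]|; last first.
  by exists [set` s] => //; rewrite /card_enat (asboolT (finite_seq s)).
apply: leq_trans sn; apply: uniq_leq_size; first exact: fset_uniq.
by move=> x; rewrite in_fset_set ?inE; last exact: finite_seq.
Qed.

Lemma int_rk_leP L n : le_enat (int_rk L) (Fin n) <->
  exists2 s : seq G, (size s <= n)%N & L `<=` generated [set` s].
Proof.
rewrite inf_enat_leP; split=> [[m mn [M [_ LM] rkM]]|[s sn Ls]].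
  have /rk_leP[s sm eM] : le_enat (rk M) (Fin m) by rewrite rkM; exact: leqnn.
  by exists s; [exact: leq_trans mn | rewrite -eM].
have : le_enat (rk (generated [set` s])) (Fin n) by apply/rk_leP; exists s.
case E : rk => [m|//] mn; exists m => //; exists (generated [set` s]) => //.
by split; first exact: generated_subgroup.
Qed.

Lemma int_rk_cons a s n : le_enat (int_rk (generated [set` s])) (Fin n) ->
  le_enat (int_rk (generated [set` a :: s])) (Fin n.+1).
Proof.
move=> /int_rk_leP[t tn st]; apply/int_rk_leP; exists (a :: t) => //=.
apply: generated_le => x /=; rewrite inE => /predU1P[->|xs].
  by apply: sub_generated; rewrite /= inE eqxx.
have /st : generated [set` s] x by exact: sub_generated.
apply: generated_le => y yt; apply: sub_generated.
by rewrite /= inE; apply/orP; right.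
Qed.

Lemma int_rk_nil : int_rk (generated [set` [::] : seq G]) = Fin 0.
Proof.
have /le_enat_anti : le_enat (int_rk (generated [set` [::] : seq G])) (Fin 0).
  by apply/int_rk_leP; exists [::].
by apply; case: int_rk.
Qed.

(* Adjoining one generator raises the intermediate rank by at most one, so the
   values along a chain of generated subgroups leave no gap. *)
Lemma int_rk_exact s r : le_enat (Fin r) (int_rk (generated [set` s])) ->
  exists t : seq G, int_rk (generated [set` t]) = Fin r.
Proof.
elim: s => [|a s IH] rs.
  by exists [::]; apply: le_enat_anti rs; rewrite int_rk_nil.
have [/IH//|nrs] := pselect (le_enat (Fin r) (int_rk (generated [set` s]))).
case: r rs nrs {IH} => [|r] rs nrs; first by case: nrs; case: int_rk.
exists (a :: s); apply: le_enat_anti rs.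
by apply: int_rk_cons; exact: le_enatNgt.
Qed.

End Generation.

(** * Coefficient sums over subsets of the group *)

Section Mass.
Variables (H : zmodType) (Gamma : groupType).
Implicit Types (S : set Gamma) (u v : {malg H[Gamma]}).
Local Open Scope ring_scope.

(** The sum behind [zero_sum], named so that it can be used as an additive map in [u]. *)
Definition mass S u : H := \sum_(s \in S) u@_s.

Lemma mass_fset S u (A : {fset Gamma}) : (msupp u `<=` A)%fset ->
  mass S u = \sum_(s <- A) if s \in S then u@_s else 0.
Proof.
move=> uA; rewrite /mass fsbig_mkcond; apply: fsbigTE => s sA.
rewrite /patch mcoeff_outdom ?if_same//.
by apply: contra sA; apply/fsubsetP.
Qed.

Lemma massD S : {morph mass S : u v / u + v}.
Proof.
move=> u v; set A := (msupp u `|` msupp v)%fset.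
rewrite (mass_fset S (msuppD_le u v)).
rewrite (@mass_fset S u A) ?fsubsetUl// (@mass_fset S v A) ?fsubsetUr//.
rewrite -big_split; apply: eq_bigr => s _ /=.
by case: ifP; rewrite ?mcoeffD ?addr0.
Qed.

Lemma mass0 S : mass S 0 = 0.
Proof. by apply: fsbig1 => s _; rewrite mcoeff0. Qed.

Lemma massN S : {morph mass S : u / - u}.
Proof. by move=> u; apply/eqP; rewrite -addr_eq0 -massD addNr mass0. Qed.

Lemma massB S : {morph mass S : u v / u - v}.
Proof. by move=> u v; rewrite massD massN. Qed.

(** Left translation by [l] permutes [S], so the shift only reindexes the sum. *)
Lemma mass_shift S l u : (forall s, S (l * s)%g <-> S s) ->
  mass S (shift l u) = mass S u.
Proof.
move=> Sl; rewrite /mass (reindex_fsbig (fun s => (l * s)%g) S S) /=; last first.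
  split=> [s /Sl//|s t _ _ /mulgI//|s Ss].
  by exists (l^-1 * s)%g; rewrite ?mulVKg//; apply/Sl; rewrite mulVKg.
by apply: eq_fsbigr => s _; rewrite shiftE mulKg.
Qed.

Lemma mass_supp S u : mass (S `&` supp u) u = mass S u.
Proof.
rewrite /mass; apply: fsbig_widen => [s []//|s [Ss ns]] /=.
by apply: mcoeff_outdom; apply/negP => us; apply: ns.
Qed.

Lemma massT S u : supp u `<=` S -> mass S u = mass setT u.
Proof. by move=> uS; rewrite -mass_supp -[RHS]mass_supp setTI (setIidr uS). Qed.

Lemma massU S (c : H) k : mass S << c *g k >> = if k \in S then c else 0.
Proof.
rewrite (@mass_fset _ _ [fset k]%fset) ?msuppU_le//.
by rewrite big_seq_fset1 mcoeffUU.
Qed.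

End Mass.

(** * Sums of displacements along a generating list *)

Section Displacement.
Variables (H : zmodType) (Gamma : groupType).
Implicit Types (S L : set Gamma) (s : seq Gamma) (l t k g : Gamma).
Implicit Types (c : H) (x y : {malg H[Gamma]}).
Local Open Scope ring_scope.
Let GN := mixed_commutator_subgroup (base H Gamma).

Lemma shiftU l c k : shift l << c *g k >> = << c *g (l * k)%g >>.
Proof.
apply/malgP => g; rewrite shiftE !mcoeffU.
by congr (c *+ nat_of_bool _); apply/eqP/eqP => [->|<-]; rewrite ?mulVKg ?mulKg.
Qed.

Lemma shiftB l x y : shift l (x - y) = shift l x - shift l y.
Proof. by apply/malgP => g; rewrite mcoeffB !shiftE mcoeffB. Qed.

Lemma mass_displacement S l y : (forall g, S (l * g)%g <-> S g) ->
  mass S (shift l y - y) = 0.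
Proof. by move=> Sl; rewrite massB mass_shift// subrr. Qed.

Lemma generated_mulg S l g : S l ->
  generated S (l * g)%g <-> generated S g.
Proof.
have [_ SM SV] := generated_subgroup S => /(@sub_generated _ S) Sl.
split; last exact: SM.
by rewrite -{2}(mulKg l g); apply: SM; exact: SV.
Qed.

(** Since [y] depends on the letter only, a repeated letter repeats its term; hence the [uniq]
    hypotheses below. *)
Definition displaced s : set {malg H[Gamma]} :=
  [set x | exists y : Gamma -> {malg H[Gamma]},
     x = \sum_(l <- s) (shift l (y l) - y l)].

Lemma displaced0 s : displaced s 0.
Proof. by exists (fun=> 0); rewrite big1// => l _; rewrite shift0 subrr. Qed.

Lemma displacedB s x y : displaced s x -> displaced s y -> displaced s (x - y).
Proof.
move=> [u ->] [v ->]; exists (fun l => u l - v l).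
rewrite -sumrB; apply: eq_bigr => l _.
by rewrite shiftB !opprB [v l - _]addrC addrACA [- u l + _]addrC.
Qed.

Lemma displacedN s x : displaced s x -> displaced s (- x).
Proof. by rewrite -(sub0r x); apply: displacedB; exact: displaced0. Qed.

Lemma displacedD s x y : displaced s x -> displaced s y -> displaced s (x + y).
Proof. by move=> sx /displacedN sy; rewrite -[y]opprK; exact: displacedB. Qed.

(** The [t] that work for all [c] and [k] form a subgroup: letting [k] vary is what allows
    displacements to be chained. *)
Lemma displacedU s t : uniq s -> generated [set` s] t ->
  forall c k, displaced s (<< c *g (t * k)%g >> - << c *g k >>).
Proof.
move=> s_uniq; apply: (generated_min (L := [set t | forall c k,
  displaced s (<< c *g (t * k)%g >> - << c *g k >>)])) => [|l /= ls c k].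
  split=> [c k|a b aD bD c k|a aD c k].
  - by rewrite mul1g subrr; exact: displaced0.
  - by rewrite -mulgA -(subrKA << c *g (b * k)%g >>); exact: displacedD.
  (* This is minus the displacement by [a] from the point [a^-1 * k]. *)
  - by rewrite -opprB -{1}(mulVKg a k); apply: displacedN.
exists (fun m => if m == l then << c *g k >> else 0).
rewrite (bigD1_seq l)//= eqxx shiftU big1 ?addr0// => m /negPf ->.
by rewrite shift0 subrr.
Qed.

(** Each coefficient is moved to the single point [g]; what gathers there is the total mass, which
    is zero. *)
Lemma displaced_coset s g x : uniq s -> mass setT x = 0 ->
    (forall k, supp x k -> generated [set` s] (k * g^-1)%g) ->
  displaced s x.
Proof.
move=> s_uniq x0 sx.
have -> : x = \sum_(k <- msupp x) (<< x@_k *g k >> - << x@_k *g g >>).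
  rewrite sumrB -monalgE -(raddf_sum (mkmalgU g)).
  move: x0; rewrite (@mass_fset _ _ _ _ (msupp x))//.
  under eq_bigr do rewrite in_setT.
  by move=> ->; rewrite raddf0 subr0.
rewrite big_seq; elim/big_ind: _ => [||k /sx kx]; first exact: displaced0.
  exact: displacedD.
have := displacedU s_uniq kx x@_k g.
by rewrite mulgVK.
Qed.

(** * Mixed commutators of the base and their length *)

Lemma mixed_commutatorP z : mixed_commutator (base H Gamma) z <->
  exists l y, z = base_inj (shift l y - y).
Proof.
(* The base is abelian, so the component [u] cancels. *)
have comm_base u l y (a : wreath H Gamma := (u, l)) :
    (a * base_inj y * a^-1 * (base_inj y)^-1)%g = base_inj (shift l y - y).
  congr pair; rewrite /= ?mulg1 ?invg1 ?mulg1 ?mulgV//.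
  by rewrite -shiftM mulgV !shift1 [u + _]addrC addrK.
split=> [[[u l] _ [_ [y _ <-] <-]]|[l [y ->]]]; first by exists l, y.
by exists (0, l) => //; exists (base_inj y); [exists y|].
Qed.

Lemma base_injD x y : base_inj (x + y) = (base_inj x * base_inj y)%g.
Proof. by congr pair; rewrite /= ?shift1 ?mulg1. Qed.

Lemma cl_leP x n : le_enat (cl (base H Gamma) (base_inj x)) (Fin n) <->
  exists2 p : seq (Gamma * {malg H[Gamma]}),
    (size p <= n)%N & x = \sum_(q <- p) (shift q.1 q.2 - q.2).
Proof.
have prodE m (F : 'I_m -> {malg H[Gamma]}) :
    (\prod_(i < m) base_inj (F i))%g = base_inj (\sum_(i < m) F i) :> wreath H Gamma.
  by apply/esym/(big_morph _ base_injD).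
rewrite inf_enat_leP; split=> [[m mn [k [c [c_mixed xE]] [km]]]|[p pn xE]].
  have /choice[q qE] i : exists q : Gamma * {malg H[Gamma]},
      c i = base_inj (shift q.1 q.2 - q.2).
    by have /mixed_commutatorP[l [y ->]] := c_mixed i; exists (l, y).
  exists [seq q i | i <- enum 'I_k]; first by rewrite size_map size_enum_ord km.
  move: xE; rewrite (eq_bigr _ (fun i _ => qE i)) prodE => -[->].
  by rewrite big_map big_enum.
exists (size p) => //; exists (size p) => //.
exists (fun i => let q := tnth (in_tuple p) i in base_inj (shift q.1 q.2 - q.2)).
split=> [i|]; first by apply/mixed_commutatorP; do 2 eexists.
by rewrite prodE xE big_tnth.
Qed.

(** Base elements of zero total mass form a subgroup, because mass is additive and
    shift-invariant. *)
Lemma mass_commutator_subgroup x : GN (base_inj x) -> mass setT x = 0.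
Proof.
suff: GN `<=` [set z | base H Gamma z /\ mass setT z.1 = 0] by move=> /[apply] -[].
have [B1 BM BV] := base_subgroup H Gamma.
apply: generated_min => [|_ /mixed_commutatorP[l [y ->]]] /=; last first.
  by split; [exists (shift l y - y) | exact: mass_displacement].
split=> /= [|a b|a].
- by rewrite mass0.
- move=> [aB a0] [bB b0]; split; first exact: BM.
  by rewrite massD mass_shift// a0 b0 addr0.
- move=> [aB a0]; split; first exact: BV.
  by rewrite mass_shift// massN a0 oppr0.
Qed.

Lemma commutator_subgroup_of_cl n x :
  le_enat (cl (base H Gamma) (base_inj x)) (Fin n) -> GN (base_inj x).
Proof.
move=> /inf_enat_leP[_ _ [m [c [c_mixed ->]] _]].
have [G1 GM _] := generated_subgroup (mixed_commutator (base H Gamma)).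
elim/big_ind: _ => // i _; exact: sub_generated.
Qed.

(** The support lies in one right coset of [L], hence of every group containing [L];
    [displaced_coset] then spends one commutator per generator. *)
Lemma cl_le_int_rk L g x : mass setT x = 0 ->
    (forall k, supp x k -> L (k * g^-1)%g) ->
  le_enat (cl (base H Gamma) (base_inj x)) (int_rk L).
Proof.
move=> x0 xL; apply/le_enatP => n /int_rk_leP[s sn Ls].
have genE : generated [set` s] = generated [set` undup s].
  by congr generated; apply/seteqP; split=> l /=; rewrite mem_undup.
have [|y xE] := @displaced_coset (undup s) g x (undup_uniq s) x0.
  by move=> k /xL/Ls; rewrite genE.
apply/cl_leP; exists [seq (l, y l) | l <- undup s]; last by rewrite big_map.
by rewrite size_map (leq_trans (size_undup s)).
Qed.

(** The translations occurring in an expression of [x] generate a group [T] on which each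
    displacement has zero mass. Condition (iii), applied to the part of the support inside [T], puts
    [L] inside [T]. *)
Lemma int_rk_le_cl L x : zero_sum_conditions x L ->
  le_enat (int_rk L) (cl (base H Gamma) (base_inj x)).
Proof.
move=> [x1 _ xL]; apply/le_enatP => n /cl_leP[p pn xE].
apply/int_rk_leP; exists [seq q.1 | q <- p]; first by rewrite size_map.
set T := generated _.
have T0 : mass T x = 0.
  rewrite xE (big_morph _ (@massD _ _ T) (mass0 _ T)) big_seq big1// => q pq.
  by apply: mass_displacement => g; apply: generated_mulg; exact: map_f.
have [T1 _ _] := generated_subgroup [set` [seq q.1 | q <- p]].
have <- : generated (T `&` supp x) = L.
  by apply: xL; [rewrite /zero_sum -/(mass _ _) mass_supp | move=> ? [] |].
by apply: generated_le => ? [].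
Qed.

Lemma cl_int_rk L x : GN (base_inj x) -> zero_sum_conditions x L ->
  cl (base H Gamma) (base_inj x) = int_rk L.
Proof.
move=> /mass_commutator_subgroup x0 xL; apply: le_enat_anti; last exact: int_rk_le_cl.
apply: (@cl_le_int_rk _ 1%g) => // k xk.
(* The whole support is a zero-sum set through the identity, so by (iii) it generates [L]. *)
have [x1 _ /(_ (supp x))<- //] := xL; first by rewrite invg1 mulg1; exact: sub_generated.
by rewrite /zero_sum -/(mass _ _) -[supp x]setTI mass_supp.
Qed.

(** Quotients of support points generate a finitely generated group to which [cl_le_int_rk] applies;
    the bound [size D] keeps the length finite even if the general rank is infinite. *)
Lemma cl_le_gen_rk x : GN (base_inj x) ->
  exists2 r, cl (base H Gamma) (base_inj x) = Fin r & le_enat (Fin r) (gen_rk Gamma).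
Proof.
move=> /mass_commutator_subgroup x0.
set D := [seq (k * h^-1)%g | k <- msupp x, h <- msupp x].
have [g xD] : exists g, forall k, supp x k -> generated [set` D] (k * g^-1)%g.
  have [[g xg]|x_empty] := pselect (exists g, supp x g); last first.
    by exists 1%g => k xk; case: x_empty; exists k.
  by exists g => k xk; apply: sub_generated; apply: allpairs_f.
have cl_le := cl_le_int_rk x0 xD.
have : le_enat (int_rk (generated [set` D])) (Fin (size D)).
  by apply/int_rk_leP; exists D.
move=> /(le_enat_trans cl_le).
case E : cl cl_le => [r|//] rD _; exists r => //; apply: le_enat_trans rD _.
have /sup_enat_lub := le_enat_refl (gen_rk Gamma); apply.
exists (generated [set` D]) => //; split; first exact: generated_subgroup.
by exists [set` D].
Qed.

End Displacement.

(** * Supports whose only zero-sum subset through the identity is the whole *)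

Section Realization.
Variable Gamma : groupType.
Implicit Types (s : seq Gamma) (x : {malg int[Gamma]}).
Local Open Scope ring_scope.

(* Value 1 on s and a balancing negative value at the identity: the support is
   then its only zero-sum subset through the identity. *)
Lemma zero_sum_witness s : s != [::] -> uniq s -> 1%g \notin s ->
  exists x, [/\ mass setT x = 0, supp x = [set` 1%g :: s] &
    zero_sum_conditions x (generated (supp x))].
Proof.
move=> s0 s_uniq s1.
set x : {malg int[Gamma]} :=
  \sum_(k <- s) << 1 *g k >> - << (size s)%:R *g 1%g >>.
have xE k : x@_k = (k \in s)%:R - (size s)%:R *+ (1%g == k).
  rewrite mcoeffB mcoeffU raddf_sum/=; congr (_ - _).
  under eq_bigr do rewrite mcoeffU.
  have [ks|ks] := boolP (k \in s); last first.
    by rewrite big_seq big1// => l ls; case: eqP ls ks => // -> ->.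
  rewrite (bigD1_seq k)//= eqxx big1 ?addr0// => l /negPf ->//.
have x_supp k : (k \in msupp x) = (k \in 1%g :: s).
  rewrite -mcoeff_neq0 xE [1%g == k]eq_sym inE; have [->|_] := eqVneq k 1%g.
    by rewrite (negPf s1) sub0r oppr_eq0 mulr1n pnatr_eq0 size_eq0.
  by rewrite mulr0n subr0; case: (k \in s).
(* Up to sign this counts the members of [s] outside [S], so it vanishes only if [S] contains all of
   [s]. *)
have x_mass (S : set Gamma) : S 1%g -> mass S x = (count [in S] s)%:R - (size s)%:R.
  move=> S1; rewrite massB massU mem_set//; congr (_ - _).
  rewrite (big_morph _ (@massD _ _ S) (mass0 _ S)).
  under eq_bigr do rewrite massU.
  by rewrite -big_mkcond -sum1_count natr_sum.
have x0 : mass setT x = 0.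
  rewrite x_mass//; apply/eqP; rewrite subr_eq0; apply/eqP; congr (_%:R).
  by apply/eqP; rewrite -all_count; apply/allP => k _; exact: mem_set.
exists x; split=> //; first by apply/seteqP; split=> k; rewrite /supp /= x_supp.
split; first by rewrite /supp /= x_supp mem_head.
  by rewrite /zero_sum -/(mass _ _) massT//; exact: sub_generated.
move=> S Sx S_supp S1; congr generated; apply/seteqP; split=> // k.
rewrite /supp /= x_supp inE => /predU1P[->//|ks].
move: Sx; rewrite /zero_sum -/(mass _ _) x_mass// => /eqP.
by rewrite subr_eq0 eqr_nat -all_count => /allP/(_ _ ks)/set_mem.
Qed.

End Realization.

Theorem theorem1p4 (Gamma : groupType) :
  let N := base int Gamma in
  let GN := mixed_commutator_subgroup N in
  [/\ forall (L : set Gamma) (x : {malg int[Gamma]}),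
        subgroup L -> GN (base_inj x) -> zero_sum_conditions x L ->
        cl N (base_inj x) = int_rk L,
      [set cl N x | x in GN]
        = [set Fin r | r in [set r : nat | le_enat (Fin r) (gen_rk Gamma)]] &
      forall r : nat, (1 <= r)%N -> le_enat (Fin r) (gen_rk Gamma) ->
        exists x : {malg int[Gamma]},
          [/\ GN (base_inj x), cl N (base_inj x) = Fin r &
              zero_sum_conditions x (generated (supp x))]].
Proof.
move=> N GN.
have realize r : (1 <= r)%N -> le_enat (Fin r) (gen_rk Gamma) ->
    exists x : {malg int[Gamma]}, [/\ GN (base_inj x), cl N (base_inj x) = Fin r &
      zero_sum_conditions x (generated (supp x))].
  case: r => // r _ r_gen.
  (* If no finitely generated [L] reached [r.+1], then [r] would bound the general rank. *)
  have [_ [[S Sfin ->] rS]] : exists L : set Gamma,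
      finitely_generated L /\ le_enat (Fin r.+1) (int_rk L).
    apply: contrapT => noL.
    have : le_enat (gen_rk Gamma) (Fin r).
      apply/sup_enat_lub => _ [L [_ Lfg] <-]; apply: le_enatNgt => rL.
      by apply: noL; exists L.
    by move/(le_enat_trans r_gen) => /=; rewrite ltnn.
  have [t] : exists t : seq Gamma, int_rk (generated [set` t]) = Fin r.+1.
    by apply: (@int_rk_exact _ (fset_set S)); rewrite fset_setK.
  have [s [s_uniq s1 ->]] := generated_uniq t => rs.
  (* The trivial group has intermediate rank 0, not [r.+1]. *)
  have s0 : s != [::] by apply/eqP => s_nil; move: rs; rewrite s_nil int_rk_nil.
  have [x [x0 x_supp xL]] := zero_sum_witness s0 s_uniq s1.
  have rx : int_rk (generated (supp x)) = Fin r.+1.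
    by rewrite x_supp generated_cons1.
  (* Membership follows from a finite bound on the commutator length. *)
  have xGN : GN (base_inj x).
    apply: (@commutator_subgroup_of_cl _ _ r.+1); rewrite -rx.
    apply: (@cl_le_int_rk _ _ _ 1%g) => // k xk.
    by rewrite invg1 mulg1; exact: sub_generated.
  by exists x; split=> //; rewrite -rx; exact: cl_int_rk.
split=> //; first by move=> L x _; exact: cl_int_rk.
apply/seteqP; split=> [_ [z zGN <-]|_ [[|r] r_gen <-]].
(* The base is a subgroup containing every mixed commutator. *)
- have [x zE] : exists x, z = base_inj x.
    have : base int Gamma z; last by move=> [x _ <-]; exists x.
    apply: generated_min zGN; first exact: base_subgroup.
    by move=> _ /mixed_commutatorP[l [y ->]]; eexists.
  rewrite zE in zGN *.
  by have [r -> r_gen] := cl_le_gen_rk zGN; exists r.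
(* The value 0 is attained by the identity, as an empty product. *)
- exists 1%g; first by have [] := generated_subgroup (mixed_commutator N).
  apply: le_enat_anti; last by case: cl.
  by apply/cl_leP; exists [::]; rewrite ?big_nil.
- by have [//|x [xGN <- _]] := realize r.+1 _ r_gen; exists (base_inj x).
Qed.
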